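(* Let $(\varepsilon_n)_{n\ge 1}$ be a sequence with $\varepsilon_n\in\{1,-1\}$ for all $n$, not identically equal to $1$, and let $r=\sqrt{2+\varepsilon_1\sqrt{2+\varepsilon_2\sqrt{2+\cdots}}}$ be the value of the corresponding continued radical. Then the continued radical is totally periodic if and only if $r=2\cos q\pi$ for some $q\in\left(0,\tfrac12\right)\cap\mathbb{Q}$ whose denominator (in lowest terms) is odd. Furthermore, in this case the minimal period of the continued radical equals $$\min\{d\in\mathbb{N} \mid 2^d\equiv \pm 1 \bmod s\},$$ where $s$ is the denominator of $q$ in lowest terms.
   Context: $\mathbb{N}=\{1,2,3,\dots\}$. For a sequence $(\varepsilon_n)_{n\ge1}$ in $\{1,-1\}$, put $r_0=\sqrt2$ and $r_n=\sqrt{2+\varepsilon_1\sqrt{2+\cdots+\varepsilon_n\sqrt{2}}}$ for $n\ge1$ (nonnegative square roots throughout). The sequence $(r_n)$ converges, and $\sqrt{2+\varepsilon_1\sqrt{2+\varepsilon_2\sqrt{2+\cdots}}}$ denotes $\lim_{n\to\infty}r_n$. The continued radical (equivalently, the sequence $(\varepsilon_n)$) is called totally periodic if there is $p\in\mathbb{N}$ such that $\varepsilon_{1+i+mp}=\varepsilon_{1+i}$ for all $m\in\mathbb{N}\cup\{0\}$ and all $i\in\{0,1,\dots,p-1\}$; such a $p$ is called a period. The minimal period is the smallest period. *)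

(* Defs.v *)
From mathcomp Require Import all_boot all_order all_algebra.
From mathcomp Require Import all_classical all_reals all_analysis.
Set Implicit Arguments.
Unset Strict Implicit.
Unset Printing Implicit Defensive.
Import Order.TTheory GRing.Theory Num.Theory.
Import numFieldNormedType.Exports.
Local Open Scope classical_set_scope.
Local Open Scope ring_scope.

(* Sign sequences are indexed from 1: the value [eps 0] is never used. *)

(* [nested_radical eps k n] is
   sqrt (2 + eps k * sqrt (2 + ... + eps (k + n - 1) * sqrt 2)),
   with n signs and n + 1 square roots. *)
Fixpoint nested_radical (R : realType) (eps : nat -> R) (k n : nat) : R :=
  if n is n'.+1
  then Num.sqrt (2 + eps k * nested_radical eps k.+1 n')
  else Num.sqrt 2.

Definition continued_radical (R : realType) (eps : nat -> R) : R :=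
  limn (nested_radical eps 1).

Definition is_period (R : realType) (eps : nat -> R) : set nat :=
  [set p | (0 < p)%N /\
    forall m i : nat, (i < p)%N -> eps (1 + i + m * p)%N = eps (1 + i)%N].

Definition totally_periodic (R : realType) (eps : nat -> R) : Prop :=
  exists p, is_period eps p.

Definition is_min (A : set nat) (m : nat) : Prop :=
  A m /\ forall n, A n -> (m <= n)%N.

(* [denq q] is the positive denominator of [q] in lowest terms. *)
Definition odd_cos_angle (R : realType) (r : R) (q : rat) : Prop :=
  [/\ 0 < q, q < 1 / 2, odd `|denq q|%N & r = 2 * cos (ratr q * pi)].

Definition pm1_exponents (s : int) : set nat :=
  [set d | (0 < d)%N /\
    ((2 ^+ d = 1 %[mod s])%Z \/ (2 ^+ d = -1 %[mod s])%Z)].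

(* Main.v *)
Require Import Defs.
From mathcomp Require Import all_boot all_order all_algebra cyclic.
From mathcomp Require Import all_classical all_reals all_analysis.
From mathcomp Require Import zify ring lra.
Import Order.TTheory GRing.Theory Num.Theory.
Import numFieldNormedType.Exports.
Local Open Scope classical_set_scope.
Local Open Scope ring_scope.

(** Write the tail of the radical starting at [eps k] as [2 cos (pi x_k)] with
    [x_k] in [[0, 1/2]] (the number [angle eps k] below).  Squaring gives
    [2 cos (2 pi x_k) = eps_k * 2 cos (pi x_(k+1))], that is, [x_(k+1) = 2 x_k]
    when [eps_k = 1] and [x_(k+1) = 1 - 2 x_k] when [eps_k = -1].  So the signs
    are the itinerary of [x_1] under the folding map of [[0, 1/2]], and shifting
    the signs by [p] changes the angle into [u 2^p x_1 + N] with [u] a sign and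
    [N] an integer ([angle_shift]).

    A period [p] therefore makes [x_1 (2^p - u)] an integer, so [x_1] is a
    rational number whose odd denominator divides [2^p - u]
    ([periodic_angle_rat]).  Conversely, let [x_1 = q] be rational in
    [(0, 1/2)] with odd denominator [s].  If [s] divides [2^p - u], the [p]-th
    shift of the angle is congruent to [q] or [- q] modulo the integers, and
    being in [[0, 1/2]] it is equal to [q].  The angles of the orbit have
    denominators dividing [s], hence avoid [1/4], the only point with two
    itineraries; so the signs repeat with period [p].  The periods are thus
    exactly the exponents [p] with [2^p = 1] or [2^p = -1] modulo [s]
    ([is_period_denq]).  Both assertions follow: such exponents exist by
    Euler's theorem, and equal sets have the same minimum. *)

Section Angles.
Set Implicit Arguments.
Unset Strict Implicit.
Unset Printing Implicit Defensive.
Variable R : realType.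
Implicit Types (eps : nat -> R) (k n : nat).

Lemma ratr_inv_nat n : ratr (1 / n%:R) = 1 / n%:R :> R.
Proof. by rewrite fmorph_div /= ratr_nat rmorph1. Qed.

(** * Radicals as cosines *)

Definition sign_sequence eps := forall n, (0 < n)%N -> eps n = 1 \/ eps n = -1.

(** The inverse branch, selected by the sign [e], of the folding map
    [x |-> min (2 x, 1 - 2 x)] of [[0, 1/2]]: [x / 2] for [e = 1] and
    [(1 - x) / 2] for [e = -1].  Angles are measured in units of [pi]. *)
Definition fold_angle (e x : R) : R := (1 - e) / 4 + e / 2 * x.

Lemma fold_angle_itv e x : e = 1 \/ e = -1 ->
  0 <= x <= 1 / 2 -> 0 <= fold_angle e x <= 1 / 2.
Proof.
by move=> [] -> /andP[x0 x1]; rewrite /fold_angle; apply/andP; split; lra.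
Qed.

(** One more square root halves the angle: [fold_angle e x] is the half of [x]
    or of [1 - x], according to the sign of [e], so this is
    [2 + 2 cos (2 t) = (2 cos t)^2] together with [cos t >= 0]. *)
Lemma sqrt_fold_angle e x : e = 1 \/ e = -1 -> 0 <= x <= 1 / 2 ->
  Num.sqrt (2 + e * (2 * cos (x * pi))) = 2 * cos (fold_angle e x * pi).
Proof.
move=> es xitv.
have cosx : e * cos (x * pi) = cos (fold_angle e x * pi *+ 2).
  case: es => ->; rewrite /fold_angle.
    by rewrite mul1r; congr cos; field.
  by rewrite mulN1r -cosDpi -cosN; rewrite -[LHS](cosD2pi); congr cos; field.
have /andP[f0 f1] := fold_angle_itv es xitv.
have pi0 := pi_gt0 R.
have c0 : 0 <= cos (fold_angle e x * pi).
  by apply: cos_ge0_pihalf; apply/andP; split; nra.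
rewrite mulrCA cosx cos_mulr2n.
rewrite (_ : 2 + _ = (2 * cos (fold_angle e x * pi)) ^+ 2); last by ring.
by rewrite sqrtr_sqr ger0_norm // mulr_ge0.
Qed.

(** The innermost radical [sqrt 2] is [2 cos (pi / 4)], whence the [1 / 4]. *)
Fixpoint approx_angle eps k n : R :=
  if n is n'.+1 then fold_angle (eps k) (approx_angle eps k.+1 n') else 1 / 4.

Lemma approx_angle_itv eps k n : sign_sequence eps -> (0 < k)%N ->
  0 <= approx_angle eps k n <= 1 / 2.
Proof.
move=> es; elim: n k => [|n IH] k k0 /=; first by lra.
exact/fold_angle_itv/IH/ltn0Sn/es.
Qed.

Lemma nested_radicalE eps k n : sign_sequence eps -> (0 < k)%N ->
  nested_radical eps k n = 2 * cos (approx_angle eps k n * pi).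
Proof.
move=> es; elim: n k => [|n IH] k k0 /=.
  have -> : 1 / 4 = fold_angle 1 (1 / 2) by rewrite /fold_angle; lra.
  rewrite -sqrt_fold_angle; [|by left|by lra].
  by rewrite (_ : 1 / 2 * pi = pi / 2) ?cos_pihalf ?mulr0 ?addr0 //; lra.
by rewrite IH // sqrt_fold_angle //; [exact: es | exact: approx_angle_itv].
Qed.

(** Each branch [fold_angle e] contracts by a factor 2, and the angles all lie
    in [[0, 1/2]]; this geometric bound is what makes the radicals converge. *)
Lemma approx_angle_step eps k n : sign_sequence eps -> (0 < k)%N ->
  `|approx_angle eps k n.+1 - approx_angle eps k n| <= 1 / 2 * (1 / 2) ^+ n.
Proof.
move=> es; elim: n k => [|n IH] k k0.
  rewrite expr0 mulr1 /= /fold_angle.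
  by case: (es _ k0) => ->; rewrite ler_norml; apply/andP; split; lra.
rewrite [X in `|X|](_ : _ = eps k / 2 *
  (approx_angle eps k.+1 n.+1 - approx_angle eps k.+1 n)); last first.
  by rewrite /= /fold_angle; ring.
rewrite normrM exprS mulrCA ler_pM //; last exact: IH.
by case: (es _ k0) => ->; rewrite ler_norml; apply/andP; split; lra.
Qed.

Lemma is_cvg_approx_angle eps k : sign_sequence eps -> (0 < k)%N ->
  cvgn (approx_angle eps k).
Proof.
move=> es k0; set a := approx_angle eps k.
have : cvgn (series (telescope a)).
  apply: normed_cvg; apply: (@series_le_cvg _ _ (geometric (1 / 2) (1 / 2))).
  - by move=> n; exact: normr_ge0.
  - by move=> n; rewrite /geometric /= mulr_ge0 // exprn_ge0.
  - by move=> n; exact: approx_angle_step.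
  by apply: is_cvg_geometric_series; rewrite ger0_norm; lra.
rewrite telescopeK => ac.
rewrite (_ : a = (fun n => (a n - a 0%N) + a 0%N)).
  by apply: is_cvgD => //; exact: is_cvg_cst.
by apply/funext => n; rewrite subrK.
Qed.

Definition angle eps k : R := limn (approx_angle eps k).

Lemma angle_itv eps k : sign_sequence eps -> (0 < k)%N ->
  0 <= angle eps k <= 1 / 2.
Proof.
move=> es k0; have ac := is_cvg_approx_angle es k0; apply/andP; split.
  apply: limr_ge => //; near=> n.
  by have /andP[] := approx_angle_itv n es k0.
apply: limr_le => //; near=> n.
by have /andP[] := approx_angle_itv n es k0.
Unshelve. all: by end_near. Qed.

Lemma angle_fold eps k : sign_sequence eps -> (0 < k)%N ->
  angle eps k = fold_angle (eps k) (angle eps k.+1).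
Proof.
move=> es k0; apply: cvg_lim => //.
rewrite -cvg_shiftS; apply: cvgD; first exact: cvg_cst.
by apply: cvgM; [exact: cvg_cst | exact: is_cvg_approx_angle].
Qed.

Lemma continued_radicalE eps : sign_sequence eps ->
  continued_radical eps = 2 * cos (angle eps 1 * pi).
Proof.
move=> es; apply: cvg_lim => //.
rewrite (_ : nested_radical eps 1 =
  fun n => 2 * cos (approx_angle eps 1 n * pi)); last first.
  by apply/funext => n; exact: nested_radicalE.
apply: cvgM; first exact: cvg_cst.
apply: continuous_cvg; first exact: continuous_cos.
by apply: cvgM; [exact: is_cvg_approx_angle | exact: cvg_cst].
Qed.

(** The cosine is injective on [[0, pi]], so the value of the radical
    determines the angle. *)
Lemma angle_of_cos eps (q : rat) : sign_sequence eps -> 0 < q -> q < 1 / 2 ->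
  continued_radical eps = 2 * cos (ratr q * pi) -> angle eps 1 = ratr q.
Proof.
move=> es q0 q1; rewrite continued_radicalE // => /mulfI e.
have pi0 := pi_gt0 R.
have q0R : 0 < ratr q :> R by rewrite ltr0q.
have q1R : ratr q < 1 / 2 :> R by rewrite -ratr_inv_nat ltr_rat.
have /andP[a0 a1] := angle_itv es (ltn0Sn 0).
have pi_neq0 : pi != 0 :> R by rewrite gt_eqF.
apply: (mulIf pi_neq0); apply: cos_inj.
- by rewrite in_itv /=; apply/andP; split; nra.
- by rewrite in_itv /=; apply/andP; split; nra.
- by apply: e; rewrite pnatr_eq0.
Qed.

(** * Dynamics of the angles *)

(** Solving [angle_fold] for the next angle: the unfolded map doubles the
    angle up to a sign and an integer. *)
Lemma angle_next eps k : sign_sequence eps -> (0 < k)%N ->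
  exists u N : int, (u = 1 \/ u = -1) /\
    angle eps k.+1 = (u * 2)%:~R * angle eps k + N%:~R.
Proof.
move=> es k0; rewrite (angle_fold es k0) /fold_angle.
case: (es _ k0) => ->; [exists 1, 0 | exists (-1), 1]; split.
- by left.
- by rewrite !rmorphM /=; field.
- by right.
- by rewrite !rmorphM /=; field.
Qed.

(** Modulo the integers and up to sign, the shift of the sign sequence acts on
    the angle as multiplication by a power of 2.  All the arithmetic of the
    periods comes from this. *)
Lemma angle_shift eps k n : sign_sequence eps -> (0 < k)%N ->
  exists u N : int, (u = 1 \/ u = -1) /\
    angle eps (k + n)%N = (u * 2 ^+ n)%:~R * angle eps k + N%:~R.
Proof.
move=> es k0; elim: n => [|n [u [N [us IH]]]].
  by exists 1, 0; split; [left | rewrite addn0 expr0 mulr1 mul1r addr0].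
have [|v [M [vs e]]] := @angle_next eps (k + n) es.
  by rewrite addn_gt0 k0.
exists (v * u), (v * 2 * N + M); split.
  by case: us vs => -> [] ->; [left|right|right|left]; lia.
by rewrite addnS e IH exprS !(rmorphM, rmorphD) /=; ring.
Qed.

(** The angle 0 is a fixed point of the branch [e = 1] and is out of the range
    of the other one, so its only itinerary is the constant sequence 1. *)
Lemma angle_gt0 eps : sign_sequence eps ->
  ~ (forall n, (0 < n)%N -> eps n = 1) ->
  0 < angle eps 1.
Proof.
move=> es not1; rewrite lt_neqAle eq_sym.
have /andP[-> _] := angle_itv es (ltn0Sn 0); rewrite andbT.
apply/eqP => a0; apply: not1.
have step k : (0 < k)%N -> angle eps k = 0 -> eps k = 1 /\ angle eps k.+1 = 0.
  move=> k0; rewrite angle_fold // /fold_angle.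
  have /andP[] := angle_itv es (ltn0Sn k).
  by case: (es _ k0) => -> h1 h2 h3; split=> //; lra.
suff all0 k : angle eps k.+1 = 0.
  by case=> // k _; have [] := step k.+1 isT (all0 k).
by elim: k => // k IH; have [] := step k.+1 isT IH.
Qed.

(** The two branches have images [[0, 1/4]] and [[1/4, 1/2]], so an angle
    determines its sign except at the common endpoint. *)
Lemma eps_of_angle eps k : sign_sequence eps -> (0 < k)%N ->
  angle eps k != 1 / 4 ->
  eps k = if angle eps k < 1 / 4 then 1 else -1.
Proof.
move=> es k0; rewrite angle_fold // /fold_angle.
have /andP[] := angle_itv es (ltn0Sn k).
case: (es _ k0) => -> h1 h2 /eqP h3; case: ltP => h4 //; exfalso; lra.
Qed.

(** * Denominators and exponents *)

(** This turns the divisibility of [2^d - u] and [2^d + u] by the denominator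
    into the integrality of multiples of [q], the form in which a return of
    the angle to its initial value is expressed ([angle_period]). *)
Lemma dvdz_denq (q : rat) (d : int) :
  (denq q %| d)%Z <-> exists N : int, q * d%:~R = N%:~R.
Proof.
split=> [/dvdzP[m ->]|[N e]].
  by exists (m * numq q); rewrite !rmorphM /= numqE; ring.
have {}e : d * numq q = N * denq q.
  by apply: (@intr_inj rat); rewrite !rmorphM /= -e numqE; ring.
have cop : coprimez (denq q) (numq q).
  by rewrite coprimezE coprime_sym coprime_num_den.
by rewrite -(Gauss_dvdzl _ cop) e dvdz_mull.
Qed.

Lemma pm1_exponentsE (s : int) d : pm1_exponents s d <->
  (0 < d)%N /\ exists u : int, (u = 1 \/ u = -1) /\ (s %| 2 ^+ d - u)%Z.
Proof.
split=> [[d0 h]|[d0 [u [us h]]]]; split=> //.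
  case: h => /eqP; rewrite eqz_mod_dvd => h.
    by exists 1; split=> //; left.
  by exists (-1); split=> //; right.
by case: us h => -> h; [left|right]; apply/eqP; rewrite eqz_mod_dvd.
Qed.

(** Euler's theorem: 2 is invertible modulo an odd number. *)
Lemma pm1_exponents_neq0 (s : int) : odd `|s| -> exists d, pm1_exponents s d.
Proof.
move=> so; exists (totient `|s|); apply/pm1_exponentsE; split.
  by rewrite totient_gt0; case: `|s|%N so.
exists 1; split; first by left.
have := Euler_exp_totient (a := 2) (n := `|s|); rewrite coprime2n so.
move=> /(_ isT) /eqP; rewrite eqn_mod_dvd ?expn_gt0 // dvdzE.
have -> : 2 ^+ totient `|s| = (2 ^ totient `|s|)%N :> int.
  by rewrite -natz natrX.
by have := expn_gt0 2 (totient `|s|); case: (2 ^ _)%N.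
Qed.

Lemma is_min_exists (A : set nat) : (exists n, A n) -> exists m, is_min A m.
Proof.
move=> [n An]; have ex : exists n, `[< A n >] by exists n; apply/asboolP.
case: (ex_minnP ex) => m /asboolP Am mle; exists m; split=> // k Ak.
by apply: mle; apply/asboolP.
Qed.

(** * Periods *)

(** The offset [i] below [p] and the number [m] of periods recombine into an
    arbitrary index by Euclidean division. *)
Lemma is_periodE eps p : is_period eps p <->
  (0 < p)%N /\ forall k, (0 < k)%N -> eps (k + p)%N = eps k.
Proof.
split=> [[p0 per]|[p0 per]]; split=> //.
  move=> [//|k] _; have kp := ltn_pmod k p0.
  have {2}-> : k = (k %% p + k %/ p * p)%N by rewrite addnC -divn_eq.
  rewrite -[X in _ = eps X]add1n addnA per // -(per (k %/ p).+1) //; congr eps.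
  by rewrite mulSn {1}(divn_eq k p); lia.
move=> m i ip; elim: m => [|m IH]; first by rewrite mul0n addn0.
by rewrite -IH -[RHS]per //; congr eps; lia.
Qed.

Lemma angle_periodic eps p k : (0 < k)%N -> is_period eps p ->
  angle eps (k + p)%N = angle eps k.
Proof.
move=> k0 /is_periodE[_ per]; congr (limn _); apply/funext => n.
elim: n k k0 => [//|n IH] k k0 /=; congr fold_angle; first exact: per.
by rewrite -addSn IH.
Qed.

(** A return of the angle to itself is the linear equation
    [x = u 2^p x + N], solved here for [x]. *)
Lemma angle_period eps p : sign_sequence eps -> is_period eps p ->
  exists u N : int, (u = 1 \/ u = -1) /\
    angle eps 1 * (2 ^+ p - u)%:~R = N%:~R.
Proof.
move=> es per; have [u [N [us]]] := angle_shift p es (ltn0Sn 0).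
rewrite angle_periodic // => e; exists u, (- u * N); split=> //.
have uu : u%:~R * u%:~R = 1 :> R by case: us => ->; rewrite /=; ring.
rewrite !(rmorphM, rmorphD, rmorphN) /= in e *.
rewrite (_ : N%:~R =
  angle eps 1 - u%:~R * (2 ^+ p)%:~R * angle eps 1); last first.
  by rewrite {1}e; ring.
rewrite [RHS](_ : _ = u%:~R * u%:~R * (2 ^+ p)%:~R * angle eps 1 -
  u%:~R * angle eps 1); last by ring.
by rewrite uu; ring.
Qed.

(** All the angles in the orbit of [q] are integral multiples of
    [1 / denq q]; this excludes [1/4] when the denominator is odd.  The
    ambiguous point of [eps_of_angle] is thus never met. *)
Lemma angle_neq_quarter eps (q : rat) k : sign_sequence eps -> odd `|denq q| ->
  angle eps 1 = ratr q -> (0 < k)%N -> angle eps k != 1 / 4.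
Proof.
move=> es qo eq; case: k => // k _; apply/eqP => e.
have [u [N [us]]] := angle_shift k es (ltn0Sn 0); rewrite add1n e eq => {}e.
have {}e : denq q = (u * 2 ^+ k * numq q + N * denq q) *+ 4.
  apply: (@intr_inj rat).
  have {}e : 1 / 4 = (u * 2 ^+ k)%:~R * q + N%:~R :> rat.
    apply: (fmorph_inj (ratr : {rmorphism rat -> R})).
    by rewrite /= ratr_inv_nat e [in RHS]rmorphD [in RHS]rmorphM /= !ratr_int.
  rewrite rmorphM /= in e.
  rewrite rmorphMn rmorphD !rmorphM /= numqE mulrA -mulrDl.
  by rewrite -e -mulr_natr mulrAC divfK ?mul1r // pnatr_eq0.
by move: qo; rewrite e -mulr_natr abszM oddM andbF.
Qed.

(** If [p] is a period, the angle [q] satisfies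
    [q (2^p - u) = N] for a sign [u], so the denominator divides [2^p - u].
    Conversely, such a divisibility makes the angle after [p] shifts equal to
    [q] or [- q] modulo the integers; lying in [[0, 1/2]] while [0 < q < 1/2],
    it must be [q] itself.  Since no angle of the orbit is [1/4], equal angles
    have equal signs, and the return of the angle propagates to the whole
    sequence. *)
Lemma is_period_denq eps (q : rat) p : sign_sequence eps ->
  0 < q -> q < 1 / 2 ->
  odd `|denq q| -> angle eps 1 = ratr q ->
  is_period eps p <-> pm1_exponents (denq q) p.
Proof.
move=> es q0 q1 qo eq.
split=> [per|/pm1_exponentsE[p0 [u [us /dvdz_denq[N qN]]]]].
  have [u [N [us e]]] := angle_period es per.
  apply/pm1_exponentsE; split; first by case: per.
  exists u; split=> //; apply/dvdz_denq; exists N.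
  apply: (fmorph_inj (ratr : {rmorphism rat -> R})).
  by rewrite /= rmorphM /= !ratr_int -eq.
have ret : angle eps (1 + p)%N = angle eps 1.
  have [v [M [vs e]]] := angle_shift p es (ltn0Sn 0).
  have {}e : angle eps (1 + p) = (v * u)%:~R * angle eps 1 + (v * N + M)%:~R.
    have qNR : ratr q * (2 ^+ p - u)%:~R = N%:~R :> R.
      by move/(congr1 (@ratr R)): qN; rewrite rmorphM /= !ratr_int.
    rewrite e !(rmorphM, rmorphD) /= -qNR eq rmorphB /=; ring.
  have /andP[a0 a1] := angle_itv es (ltn0Sn p).
  rewrite -add1n e in a0 a1 *.
  have q0R : 0 < ratr q :> R by rewrite ltr0q.
  have q1R : ratr q < 1 / 2 :> R.
    by rewrite -ratr_inv_nat ltr_rat.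
  rewrite eq in a0 a1 *; set K := (v * N + M) in a0 a1 *.
  (* The angle after p shifts is v u q + K; its range forces K = 0 when
     v u = 1 and leaves no integer K when v u = -1. *)
  have : v * u = 1 \/ v * u = -1 by case: us vs => -> [] ->; lia.
  case=> vu; rewrite vu in a0 a1 *.
    suff -> : K = 0 by ring.
    have : K%:~R < (1 : int)%:~R :> R by rewrite /=; lra.
    have : (-1 : int)%:~R < K%:~R :> R by rewrite /= ; lra.
    rewrite !ltr_int; lia.
  exfalso.
  have : K%:~R < (1 : int)%:~R :> R by rewrite /=; lra.
  have : (0 : int)%:~R < K%:~R :> R by rewrite /= ; lra.
  rewrite !ltr_int; lia.
apply/is_periodE; split=> //.
have step k : (0 < k)%N -> angle eps (k + p) = angle eps k ->
    eps (k + p)%N = eps k.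
  move=> k0 e; have neq := angle_neq_quarter es qo eq k0.
  by rewrite (eps_of_angle es k0 neq) -e eps_of_angle ?e // addn_gt0 k0.
suff back k : angle eps (k.+1 + p) = angle eps k.+1.
  by case=> // k _; exact: step.
elim: k => // k IH.
have := step _ _ IH => /(_ isT) ek.
move: IH; rewrite [LHS]angle_fold ?addn_gt0 // [RHS]angle_fold // ek.
rewrite /fold_angle.
by rewrite -addSn; case: (es k.+1 isT) => -> h; lra.
Qed.

(** Solving [x = u 2^p x + N] gives a denominator dividing the odd number
    [2^p - u].  The endpoint 0 is excluded by the hypothesis on the signs and
    the endpoint 1/2 by the parity of its denominator. *)
Lemma periodic_angle_rat eps p : sign_sequence eps ->
  ~ (forall n, (0 < n)%N -> eps n = 1) -> is_period eps p ->
  exists q : rat, [/\ 0 < q, q < 1 / 2, odd `|denq q| & angle eps 1 = ratr q].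
Proof.
move=> es not1 per; have [u [N [us e]]] := angle_period es per.
have Do : odd `|2 ^+ p - u|.
  case: per => p0 _; have -> : 2 ^+ p = 2 * 2 ^+ p.-1 :> int.
    by rewrite -exprS prednK.
  by case: us => ->; lia.
set D := 2 ^+ p - u in e Do.
have D0 : D != 0 by apply: contraTneq Do => ->.
pose q : rat := N%:~R / D%:~R.
have eq : angle eps 1 = ratr q.
  rewrite /q fmorph_div /= !ratr_int -e mulfK //.
  by rewrite intr_eq0.
have qo : odd `|denq q|.
  have : (denq q %| D)%Z.
    by apply/dvdz_denq; exists N; rewrite /q divfK // intr_eq0.
  by rewrite dvdzE => /dvdn_odd; apply.
exists q; split=> //.
  by rewrite -(ltr0q R) -eq; exact: angle_gt0.
have /andP[_] := angle_itv es (ltn0Sn 0); rewrite eq.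
rewrite -ratr_inv_nat ler_rat le_eqVlt.
by case/orP => // /eqP q2; move: qo; rewrite q2.
Qed.

End Angles.

Theorem theorem4 (R : realType) (eps : nat -> R)
    (eps_sign : forall n : nat, (0 < n)%N -> eps n = 1 \/ eps n = -1)
    (eps_not1 : ~ (forall n : nat, (0 < n)%N -> eps n = 1)) :
  (totally_periodic eps <->
     exists q : rat, odd_cos_angle (continued_radical eps) q) /\
  (totally_periodic eps ->
   forall q : rat, odd_cos_angle (continued_radical eps) q ->
     exists p : nat,
       is_min (is_period eps) p /\ is_min (pm1_exponents (denq q)) p).
Proof.
have periods q : odd_cos_angle (continued_radical eps) q ->
    is_period eps = pm1_exponents (denq q).
  move=> [q0 q1 qo r]; have a := angle_of_cos eps_sign q0 q1 r.
  by apply/seteqP; split=> p /(is_period_denq p eps_sign q0 q1 qo a).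
split; first split.
- move=> [p per].
  have [q [q0 q1 qo a]] := periodic_angle_rat eps_sign eps_not1 per.
  by exists q; split=> //; rewrite (continued_radicalE eps_sign) a.
- move=> [q r]; rewrite /totally_periodic (periods q r).
  by case: r => _ _ qo _; exact: pm1_exponents_neq0.
- move=> _ q r; rewrite (periods q r).
  case: r => _ _ qo _.
  have [p pmin] := is_min_exists (pm1_exponents_neq0 qo).
  by exists p.
Qed.
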